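(* Let $G$ be a finite simple graph of treewidth $k$ and maximum degree $\Delta(G) \geq k$. Then $$2|E(G)| \leq \Delta(G)\,|V(G)| - (\Delta(G)-k)(\Delta(G)-k+1).$$
   Context: All graphs are finite and simple. $\Delta(G)$ is the maximum degree of $G$. A tree-decomposition of $G$ consists of a tree $T$ and a collection of bags $B_t \subseteq V(G)$, $t\in V(T)$, such that (i) $V(G)=\bigcup_{t\in V(T)} B_t$; (ii) for each edge $vw\in E(G)$ there is $t\in V(T)$ with $v,w\in B_t$; (iii) if $v\in B_s\cap B_t$ then $v\in B_r$ for every vertex $r$ on the path connecting $s$ and $t$ in $T$. It has width $k$ if each bag has size at most $k+1$. The treewidth of $G$ is the smallest integer $k$ for which there is a width $k$ tree-decomposition of $G$. *)

(* Defs.v *)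
From mathcomp Require Import all_boot.

Set Implicit Arguments.
Unset Strict Implicit.
Unset Printing Implicit Defensive.

Record sgraph := SGraph {
  vertex :> finType;
  adj : rel vertex;
  adj_sym : symmetric adj;
  adj_irrefl : irreflexive adj
}.
Arguments adj {s} : rename.

Definition edges (G : sgraph) : {set {set G}} :=
  [set e : {set G} | [exists x : G, exists y : G, adj x y && (e == [set x; y])]].

Definition degree (G : sgraph) (v : G) : nat := #|[set w : G | adj v w]|.

Definition max_degree (G : sgraph) : nat := \max_(v : G) degree v.

Definition connected_graph (G : sgraph) : Prop :=
  0 < #|G| /\ forall x y : G, connect adj x y.

(* The size condition is needed because [:: x; y] is a ucycle for every edge xy. *)
Definition acyclic (G : sgraph) : Prop :=
  forall c : seq G, 2 < size c -> ~ ucycle adj c.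

Definition is_tree (G : sgraph) : Prop := connected_graph G /\ acyclic G.

(* The simple path from s to t is given as s :: p; it is unique in a tree. *)
Record tree_decomposition (G T : sgraph) (B : T -> {set G}) : Prop := {
  td_tree : is_tree T;
  td_vertices : \bigcup_(t : T) B t = [set: G];
  td_edges : forall v w : G, adj v w -> exists t : T, v \in B t /\ w \in B t;
  td_paths : forall (v : G) (s t : T) (p : seq T),
    v \in B s :&: B t ->
    path adj s p -> uniq (s :: p) -> last s p = t ->
    forall r : T, r \in s :: p -> v \in B r
}.

Definition has_width (G T : sgraph) (B : T -> {set G}) (k : nat) : Prop :=
  forall t : T, #|B t| <= k.+1.

Definition has_td_of_width (G : sgraph) (k : nat) : Prop :=
  exists (T : sgraph) (B : T -> {set G}),
    tree_decomposition B /\ has_width B k.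

(* Natural numbers suffice: when G has a vertex some bag is nonempty, so no
   negative integer is a width. The graph without vertices gets treewidth 0. *)
Definition treewidth_is (G : sgraph) (k : nat) : Prop :=
  has_td_of_width G k /\ forall j : nat, has_td_of_width G j -> k <= j.

(* Main.v *)
(** A tree-decomposition of width [k] of a graph on [n > k] vertices can be refined
    so that it has [n - k] bags, all of size [k+1], each one obtained from an earlier
    bag by exchanging one vertex for a new one. If [v] lies in [c v] of the refined
    bags then [deg v < k + c v], so with [d = Delta - k] the deficit
    [Delta - deg v] is at least [d + 1 - min (d + 1) (c v)]. It remains to bound
    [\sum_v min (d + 1) (c v)]. For the first [d + 1] bags, counting incidences
    gives [(k + 1) (d + 1)]; each further bag adds at most [d + 1], because at most
    [d + 1] of its vertices lie in at most [d + 1] bags. Since [n > Delta], there are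
    at least [d + 1] bags, and the deficits sum to at least [d (d + 1)]. *)

Require Import Defs.
From mathcomp Require Import all_boot all_order all_algebra.
From mathcomp Require Import zify.
Import Order.TTheory GRing.Theory Num.Theory.
Local Open Scope ring_scope.

Set Implicit Arguments.
Unset Strict Implicit.

(** * Bag sequences of [k]-trees, and families of sets covered by their bags *)

Section KTrees.
Local Open Scope nat_scope.
Variables (V : finType) (k : nat).
Implicit Types (A C D S U : {set V}) (bs : seq {set V}) (v w x y : V).

Definition mult bs v := count (fun A => v \in A) bs.

Arguments mult : simpl never.

Definition support bs := [set v | 0 < mult bs v].

(** Construction sequences of [k]-trees, newest bag first: the new vertex [y] is attached to the
    [k]-clique [A :\ x]. *)
Inductive ktree_bags : seq {set V} -> Prop :=
| KtreeBase A : #|A| = k.+1 -> ktree_bags [:: A]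
| KtreeStep bs A x y :
    ktree_bags bs -> A \in bs -> x \in A -> y \notin support bs ->
    ktree_bags ((y |: (A :\ x)) :: bs).

Lemma mult_cons A bs v : mult (A :: bs) v = (v \in A) + mult bs v.
Proof. by []. Qed.

Lemma mult_gt0 A bs v : A \in bs -> v \in A -> 0 < mult bs v.
Proof. by move=> Abs vA; rewrite -has_count; apply/hasP; exists A. Qed.

Lemma notin_support A bs y : A \in bs -> y \notin support bs -> y \notin A.
Proof. by move=> Abs; apply: contra => yA; rewrite inE (mult_gt0 Abs). Qed.

Lemma ktree_card bs A : ktree_bags bs -> A \in bs -> #|A| = k.+1.
Proof.
move=> kt; elim: kt A => [A cA|{}bs A x y _ IH Abs xA ynew] B.
  by rewrite inE => /eqP->.
rewrite inE => /predU1P[->|/IH//].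
rewrite -(IH _ Abs) cardsU1 (cardsD1 x A) xA.
by rewrite !inE (negPf (notin_support Abs ynew)) andbF.
Qed.

Lemma ktree_support_cons bs A x y : A \in bs ->
  support ((y |: (A :\ x)) :: bs) = y |: support bs.
Proof.
move=> Abs; apply/setP=> v; rewrite !inE mult_cons !inE addn_gt0 lt0b -orbA.
case: (v == y) => //=; case vA: (v \in A); last by rewrite andbF.
by rewrite (mult_gt0 Abs vA) orbT.
Qed.

Lemma ktree_size bs : ktree_bags bs -> #|support bs| = k + size bs.
Proof.
elim=> [A cA|{}bs A x y _ IH Abs _ ynew] /=.
  rewrite addn1 -cA; apply: eq_card => v.
  by rewrite inE mult_cons addn0 lt0b.
by rewrite ktree_support_cons // cardsU1 ynew IH addnS.
Qed.

(** Induction on the sequence. Every vertex of the newest bag except [y] gains one occurrence over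
    its count in [A], so the bound passes from [m] to [m.+1]. For an older bag multiplicities only
    grow; the delicate case is [size bs = m.+1]. *)
Lemma ktree_bag_mult bs A m : ktree_bags bs -> A \in bs -> m < size bs ->
  #|[set v in A | mult bs v <= m]| <= m.
Proof.
have le0 bs' B : B \in bs' -> #|[set v in B | mult bs' v <= 0]| <= 0.
  move=> Bin; rewrite leqn0 cards_eq0; apply/eqP/setP=> v; rewrite !inE.
  by apply/negP => /andP[/(mult_gt0 Bin)]; rewrite lt0n leqn0 => /negPf->.
move=> kt; elim: kt A m => [C cC|{}bs A x y kt IH Abs xA ynew] B [|m] //=;
  try by [move=> + _; apply: le0].
rewrite inE => /predU1P[->|Bbs] lt_m.
  apply: (@leq_trans #|y |: [set v in A | mult bs v <= m]|).
    apply/subset_leq_card/subsetP=> v; rewrite !inE mult_cons !inE.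
    by case: (v == y) => //= /andP[/andP[-> ->]].
  by rewrite cardsU1; apply: leq_add (leq_b1 _) (IH _ _ Abs _).
have [lt|le] := ltnP m.+1 (size bs).
  apply: leq_trans (IH _ _ Bbs lt); apply/subset_leq_card/subsetP=> v.
  rewrite !inE mult_cons => /andP[-> /=]; apply: leq_trans; exact: leq_addl.
have sz : size bs = m.+1 by apply/eqP; rewrite eqn_leq le.
(* A vertex of [B] lying in all [m.+1] old bags but not in the new one is [x]. *)
apply: (@leq_trans #|x |: [set v in B | mult bs v <= m]|).
  apply/subset_leq_card/subsetP=> v; rewrite !inE mult_cons !inE => /andP[-> /=].
  case: (leqP (mult bs v) m) => [|lt_m_v]; first by rewrite orbT.
  rewrite orbF => le'.
  have vAll : all (fun A => v \in A) bs.
    by rewrite all_count eqn_leq count_size sz.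
  apply: contraLR le' => ->; rewrite (allP vAll _ Abs) orbT add1n -ltnNge.
  by rewrite ltnS.
by rewrite cardsU1; apply: leq_add (leq_b1 _) (IH _ _ Bbs _); rewrite sz.
Qed.

Lemma sum_mem A : \sum_v (v \in A) = #|A|.
Proof. by rewrite -sum1_card [RHS]big_mkcond; apply: eq_bigr => v _; case: (_ \in _). Qed.

Lemma sum_mult bs : \sum_v mult bs v = \sum_(A <- bs) #|A|.
Proof.
elim: bs => [|A bs IH]; first by rewrite big_nil big1.
by rewrite big_cons -IH -sum_mem -big_split.
Qed.

Lemma ktree_sum_mult bs : ktree_bags bs -> \sum_v mult bs v = size bs * k.+1.
Proof.
move=> kt; rewrite sum_mult big_seq (eq_bigr (fun=> k.+1)) => [|A /(ktree_card kt)//].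
by rewrite -big_seq big_const_seq iter_addn_0 count_predT mulnC.
Qed.

(** The term [m * m] stands on the left to avoid truncated subtraction. The induction removes bags
    until exactly [m] are left. *)
Lemma ktree_sum_min bs m : ktree_bags bs -> m <= size bs ->
  \sum_v minn m (mult bs v) + m * m <= m * (k.+1 + size bs).
Proof.
have sz_eq bs' : ktree_bags bs' ->
    \sum_v minn (size bs') (mult bs' v) <= size bs' * k.+1.
  by move=> kt; rewrite -ktree_sum_mult //; apply: leq_sum => v _; apply: geq_minr.
move=> kt; elim: kt m => [A cA|{}bs A x y kt IH Abs xA ynew] m.
  rewrite leq_eqVlt => /predU1P[->|].
    by rewrite mulnDr leq_add2r; apply/sz_eq/KtreeBase.
  rewrite ltnS leqn0 => /eqP->; rewrite big1 // => v _; by rewrite min0n.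
have kt' := KtreeStep kt Abs xA ynew.
rewrite leq_eqVlt => /predU1P[->|lt_m].
  by rewrite mulnDr leq_add2r; apply: sz_eq.
set A' := y |: (A :\ x) in kt' lt_m *.
have := ktree_bag_mult kt' (mem_head _ _) lt_m.
rewrite -sum_mem => le_m.
(* The new bag raises the minimum, by one, exactly at its vertices of new multiplicity at most
   [m]. *)
have -> : \sum_v minn m (mult (A' :: bs) v)
    = \sum_v minn m (mult bs v)
      + \sum_v (v \in [set v in A' | mult (A' :: bs) v <= m]).
  rewrite -big_split; apply: eq_bigr => v _ /=; rewrite inE mult_cons.
  case: (v \in A'); lia.
move: lt_m; rewrite /= ltnS => /IH; lia.
Qed.

(** The oldest bag containing [v] has [k.+1] vertices, and each later one containing [v] contributes
    at most its new vertex [y]. *)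
Lemma ktree_neighbours bs v : ktree_bags bs ->
  #|[set w | has (fun A => (v \in A) && (w \in A)) bs]| <= k + mult bs v.
Proof.
elim=> [A cA|{}bs A x y kt IH Abs xA ynew].
  rewrite mult_cons addn0; case vA: (v \in A).
    rewrite addn1 -cA; apply/subset_leq_card/subsetP=> w.
    by rewrite inE /= orbF => /andP[].
  by rewrite (_ : [set w | _] = set0) ?cards0 //; apply/setP=> w; rewrite !inE /= vA.
have kt' := KtreeStep kt Abs xA ynew.
set A' := y |: (A :\ x) in kt' *.
have [->|vy] := eqVneq v y.
  rewrite mult_cons setU11 addnA.
  apply: leq_trans (leq_addr _ _); rewrite addn1 -(ktree_card kt' (mem_head _ _)).
  apply/subset_leq_card/subsetP=> w; rewrite inE /= => /orP[/andP[]//|].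
  by case/hasP=> B Bbs /andP[yB _]; rewrite inE (mult_gt0 Bbs yB) in ynew.
rewrite mult_cons addnCA; case vA': (v \in A'); last first.
  apply: leq_trans (leq_addl _ _); apply: leq_trans IH.
  by apply/subset_leq_card/subsetP=> w; rewrite !inE /= vA'.
apply: (@leq_trans #|y |: [set w | has (fun A => (v \in A) && (w \in A)) bs]|).
  apply/subset_leq_card/subsetP=> w; rewrite !inE /= vA' /= => /orP[|->]; last first.
    by rewrite orbT.
  rewrite !inE; case: (w == y) => //= /andP[_ wA]; apply/hasP; exists A => //.
  by move: vA'; rewrite !inE (negPf vy) wA => /andP[_ ->].
by rewrite cardsU1; apply: leq_add (leq_b1 _) IH.
Qed.

(* Below [k.+1] vertices there are no bags of full size yet. *)
Definition realized U (F : {set {set V}}) : Prop :=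
  #|U| <= k \/
  exists bs, [/\ ktree_bags bs, support bs = U
    & forall S, S \in F -> exists2 A, A \in bs & S \subset A].

Lemma realized_small U (F : {set {set V}}) : #|U| <= k.+1 ->
  (forall S, S \in F -> S \subset U) -> realized U F.
Proof.
rewrite leq_eqVlt => /predU1P[cU FU|]; last by left.
right; exists [:: U]; split; first exact: KtreeBase.
  by apply/setP=> v; rewrite inE mult_cons addn0 lt0b.
by move=> S /FU SU; exists U; rewrite ?mem_head.
Qed.

Lemma realized_add1 U (F : {set {set V}}) C y :
  realized U F -> (forall S, S \in F -> S \subset U) -> C \in F ->
  #|C| <= k -> y \notin U -> realized (y |: U) ((y |: C) |: F).
Proof.
move=> rU FU CF cC yU; case: rU => [small|[bs [kt sup cov]]].
  apply: realized_small => [|S]; first by rewrite cardsU1 yU.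
  rewrite inE => /orP[/set1P->|/FU SU]; first exact/setUS/FU.
  exact: subset_trans SU (subsetUr _ _).
have [A Abs CA] := cov _ CF.
(* As [C] is smaller than [A], some [x] can be exchanged for [y] without losing a vertex of [C]. *)
have [x xA xC] : exists2 x, x \in A & x \notin C.
  apply/subsetPn; apply/negP=> /subset_leq_card.
  by rewrite (ktree_card kt Abs) leqNgt ltnS cC.
right; exists ((y |: (A :\ x)) :: bs); split.
- by apply: KtreeStep => //; rewrite sup.
- by rewrite ktree_support_cons // sup.
move=> S; rewrite inE => /orP[/set1P->|/cov[B Bbs SB]]; last first.
  by exists B; rewrite // inE Bbs orbT.
by exists (y |: (A :\ x)); rewrite ?mem_head // setUS // subsetD1 CA.
Qed.

(** The vertices of [D] outside [U] are added one at a time: [D :\ y] is attached first, and then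
    serves as the set [C] to which [y] is joined. *)
Lemma realized_add U (F : {set {set V}}) S D :
  realized U F -> (forall S, S \in F -> S \subset U) -> S \in F ->
  #|D| <= k.+1 -> D :&: U \subset S -> realized (D :|: U) (D |: F).
Proof.
move=> rU FU SF; have [n le_n] := ubnP #|D :\: U|.
elim: n D le_n => // n IH D le_n cD DS.
have [D0|[y yDU]] := set_0Vmem (D :\: U).
  have DU : D \subset U by rewrite -setD_eq0 D0.
  rewrite (setUidPr DU); rewrite (setIidPl DU) in DS.
  case: rU => [|[bs [kt sup cov]]]; first by left.
  right; exists bs; split=> // S'; rewrite inE => /orP[/set1P->|/cov//].
  by have [A Abs SA] := cov _ SF; exists A; rewrite // (subset_trans DS).
have [yD yU] : y \in D /\ y \notin U by move: yDU; rewrite inE => /andP[].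
have cDy : #|D :\ y| <= k by move: cD; rewrite (cardsD1 y) yD.
have r : realized (D :\ y :|: U) ((D :\ y) |: F).
  apply: IH; [|exact: leq_trans cDy _|].
    move: le_n; rewrite (cardsD1 y) yDU ltnS; apply: leq_trans.
    rewrite ltnS; apply/subset_leq_card/subsetP=> v; rewrite !inE.
    by case/and3P=> -> -> ->.
  by apply: subset_trans DS; rewrite setSI // subsetDl.
have := realized_add1 (y := y) (C := D :\ y) r.
rewrite !setUA setD1K // => /(_ _ _ cDy) [|||small|[bs [kt sup cov]]].
- by move=> S'; rewrite inE => /orP[/set1P->|/FU/subset_trans->//];
    rewrite ?subsetUl ?subsetUr.
- by rewrite inE set11.
- by rewrite !inE eqxx (negPf yU).
- by left.
right; exists bs; split=> // S' S'F; apply: cov; move: S'F; rewrite !inE.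
by case/orP=> ->; rewrite ?orbT.
Qed.

End KTrees.

(** * Refining a tree-decomposition *)

Section TreeDecompositions.
Local Open Scope nat_scope.

Lemma path_leaves (T : finType) (e : rel T) (R : {set T}) r p :
  path e r p -> r \in R -> last r p \notin R ->
  exists a b, [/\ a \in R, b \notin R & e a b].
Proof.
elim: p r => [|b p IH] r /=; first by move=> _ ->.
case/andP=> erb pb rR; have [bR|bR _] := boolP (b \in R); first exact: IH.
by exists r, b.
Qed.

Definition adj_in (T : sgraph) (R : {set T}) : rel T :=
  [rel a b | [&& adj a b, a \in R & b \in R]].

Lemma path_adj_in (T : sgraph) (R : {set T}) r p :
  path (adj_in R) r p -> path adj r p /\ {subset p <= R}.
Proof.
elim: p r => [|b p IH] r //= /andP[/and3P[rb _ bR] /IH[pb sub]]; split.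
  by rewrite rb.
by move=> c; rewrite inE => /predU1P[->|/sub].
Qed.

(** A simple path inside [R] from [r] to [p], prolonged by the edge to [s], is a simple path through
    [p], so [B p] contains whatever [B r] and [B s] share. *)
Lemma td_separation (G T : sgraph) (B : T -> {set G}) (R : {set T}) p s :
  tree_decomposition B -> {in R &, forall a b, connect (adj_in R) a b} ->
  p \in R -> s \notin R -> adj p s ->
  B s :&: \bigcup_(r in R) B r \subset B p.
Proof.
move=> td con pR sR ps; apply/subsetP=> v /setIP[vs /bigcupP[r rR vr]].
have /connectP[q0 pq0 def_p] := con _ _ rR pR.
case/shortenP: pq0 def_p => q pq uq _ def_p.
have [pq' qR] := path_adj_in pq.
apply: (td_paths td (v := v) (s := r) (t := s) (p := rcons q s)).
- by rewrite inE vr.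
- by rewrite rcons_path pq' -def_p.
- rewrite -rcons_cons rcons_uniq uq andbT inE negb_or.
  apply/andP; split; first by apply: contraNneq sR => ->.
  by apply: contra sR; apply: qR.
- by rewrite last_rcons.
by rewrite -rcons_cons mem_rcons inE def_p mem_last orbT.
Qed.

(** A connected set [R] of nodes is grown by one node [s] at a time; the bag of its neighbour [p] in
    [R] contains all old vertices of [B s]. *)
Lemma td_realized (G T : sgraph) (B : T -> {set G}) k :
  tree_decomposition B -> has_width B k ->
  realized k [set: G] (B @: [set: T]).
Proof.
move=> td wB; have [[T0 conT] _] := td_tree td.
suff grow n : 0 < n <= #|T| -> exists R : {set T}, [/\ #|R| = n,
    {in R &, forall a b, connect (adj_in R) a b}
    & realized k (\bigcup_(t in R) B t) (B @: R)].
  have [|R [cR _]] := grow #|T|; first by rewrite T0 leqnn.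
  have -> : R = [set: T] by apply/eqP; rewrite eqEcard subsetT cardsT cR leqnn.
  have <- : \bigcup_t B t = \bigcup_(t in [set: T]) B t.
    by apply: eq_bigl => t; rewrite inE.
  by rewrite (td_vertices td).
elim: n => // -[_ _|n IH /= lt_n].
  have /card_gt0P[t _] := T0; exists [set t]; split; first by rewrite cards1.
    by move=> a b /set1P-> /set1P->; apply: connect0.
  rewrite big_set1 imset_set1; apply: realized_small => // S /set1P->//.
have [|R [cR con rR]] := IH; first exact: ltnW.
have /card_gt0P[r rin] : 0 < #|R| by rewrite cR.
have [z zR] : exists z, z \notin R.
  apply/existsP; rewrite -negb_forall; apply: contraL lt_n => /forallP RT.
  by rewrite -leqNgt -cR; apply/subset_leq_card/subsetP=> t _.
have /connectP[q pq def_z] := conT r z; rewrite def_z in zR.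
have [p [s [pR sR ps]]] := path_leaves pq rin zR.
exists (s |: R); split; first by rewrite cardsU1 sR cR.
  have sym : connect_sym (adj_in (s |: R)).
    by apply: sym_connect_sym => a b; rewrite /adj_in /= adj_sym [X in _ && X]andbC.
  have top a : a \in s |: R -> connect (adj_in (s |: R)) a p.
    rewrite inE => /orP[/set1P->|aR].
      by rewrite sym; apply: connect1; rewrite /adj_in /= ps !inE pR eqxx orbT.
    apply: connect_sub (con _ _ aR pR) => c d /and3P[cd c_in d_in].
    by apply: connect1; rewrite /adj_in /= cd !inE c_in d_in !orbT.
  by move=> a b /top ap /top; rewrite sym; apply: connect_trans.
rewrite bigcup_setU big_set1 imsetU1.
apply: (realized_add (S := B p)) => //.
- by move=> S /imsetP[t tR ->]; apply: bigcup_sup.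
- exact: imset_f.
exact: td_separation.
Qed.

End TreeDecompositions.

(** * Degrees and edge counts *)

Section Counting.
Local Open Scope nat_scope.

Lemma incident_edges_le_degree (G : sgraph) (v : G) :
  #|[set e in edges G | v \in e]| <= degree v.
Proof.
apply: leq_trans (leq_imset_card (fun w => [set v; w]) [set w | adj v w]).
apply/subset_leq_card/subsetP=> e; rewrite !inE => /andP[].
case/existsP=> x /existsP[y /andP[xy /eqP->]]; rewrite !inE => /orP[]/eqP->.
  by apply/imsetP; exists y; rewrite ?inE.
by apply/imsetP; exists x; rewrite ?inE 1?adj_sym // setUC.
Qed.

Lemma edge_card (G : sgraph) (e : {set G}) : e \in edges G -> #|e| = 2.
Proof.
rewrite inE => /existsP[x /existsP[y /andP[xy /eqP->]]]; rewrite cards2.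
by case: eqP xy => // ->; rewrite adj_irrefl.
Qed.

Lemma edges_le_sum_degree (G : sgraph) : 2 * #|edges G| <= \sum_(v : G) degree v.
Proof.
apply: (@leq_trans (\sum_(v : G) #|[set e in edges G | v \in e]|)); last first.
  by apply: leq_sum => v _; apply: incident_edges_le_degree.
rewrite mulnC -sum_nat_const.
under [leqRHS]eq_bigr do rewrite -sum1dep_card big_mkcondr.
rewrite exchange_big; apply: leq_sum => e /edge_card {1}<-.
by rewrite -sum_mem; apply: leq_sum => v _; case: (v \in e).
Qed.

Lemma degree_le_max (G : sgraph) (v : G) : degree v <= max_degree G.
Proof. exact: (leq_bigmax v). Qed.

Lemma max_degree_lt_card (G : sgraph) : 0 < #|G| -> max_degree G < #|G|.
Proof.
move=> G0; rewrite /max_degree; have [v ->] := @bigop.eq_bigmax G (@degree G) G0.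
rewrite -cardsT; apply/proper_card/properP; split; first exact: subsetT.
by exists v; rewrite !inE // adj_irrefl.
Qed.

(** The inequality is strict because [v] shares a bag with itself but is not its own neighbour. *)
Lemma ktree_degree (G : sgraph) k (bs : seq {set G}) v :
  ktree_bags k bs ->
  (forall x y : G, adj x y -> has (fun A : {set G} => (x \in A) && (y \in A)) bs) ->
  v \in support bs -> degree v < k + mult bs v.
Proof.
move=> kt cov vs; apply: leq_trans (ktree_neighbours v kt).
apply/proper_card/properP; split.
  by apply/subsetP=> w; rewrite !inE; apply: cov.
exists v; rewrite inE ?adj_irrefl //.
by move: vs; rewrite inE -has_count; apply: sub_has => A /= ->.
Qed.

End Counting.

Theorem proposition4 (G : sgraph) (k : nat)
    (htw : treewidth_is G k) (hdeg : (k <= max_degree G)%N) :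
  2%:Z * #|edges G|%:Z <=
    (max_degree G)%:Z * #|G|%:Z
    - ((max_degree G)%:Z - k%:Z) * ((max_degree G)%:Z - k%:Z + 1).
Proof.
have [G0|G0] := posnP #|G|.
  have D0 : max_degree G = 0%N.
    by rewrite /max_degree big1 // => v; have := max_card (pred1 v); rewrite G0 card1.
  have k0 : k = 0%N by apply/eqP; rewrite -leqn0 -D0.
  have E0 : #|edges G| = 0%N.
    have := edges_le_sum_degree G; rewrite big1 => [|v _]; first by lia.
    by apply/eqP; rewrite -leqn0 -D0 degree_le_max.
  by rewrite G0 D0 k0 E0.
have lt_D := max_degree_lt_card G0.
have [[T [B [td wB]]] _] := htw.
(* The alternative of at most [k] vertices contradicts [k <= max_degree G < #|G|]. *)
case: (td_realized td wB) => [|[bs [kt sup cov]]].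
  by rewrite cardsT; lia.
have sz := ktree_size kt; rewrite sup cardsT in sz.
have edge_cov (x y : G) : adj x y -> has (fun A : {set G} => (x \in A) && (y \in A)) bs.
  move=> /(td_edges td)[t [xt yt]]; have [|A Abs sA] := cov (B t).
    exact: imset_f.
  by apply/hasP; exists A => //; rewrite !(subsetP sA).
set m := (max_degree G - k).+1.
have lem : (m <= size bs)%N by rewrite /m; lia.
(* For each [v], use [degree v <= max_degree G] if the minimum is [m], and
   [degree v < k + mult bs v] otherwise. *)
have le_min : (\sum_(v : G) degree v + #|G| * m
    <= #|G| * max_degree G + \sum_(v : G) minn m (mult bs v))%N.
  rewrite -!sum_nat_const -!big_split; apply: leq_sum => v _ /=.
  have := degree_le_max v.
  have := @ktree_degree G k bs v kt edge_cov; rewrite sup inE => /(_ isT).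
  rewrite /m; lia.
(* Since [size bs = #|G| - k], the minima sum to at most [m * (#|G| + 1 - m)]; hence the degrees sum
   to at most [#|G| * max_degree G - m * (m - 1)]. *)
have := ktree_sum_min kt lem; have := edges_le_sum_degree G.
rewrite sz in le_min *; move: le_min lem.
rewrite /m; nia.
Qed.
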